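(* Let $(G,o)$ be a Menger algebra of rank $n$ and let $\varepsilon$ be an $l$-cancellative $l$-congruence on $(G,o)$. Then each $\varepsilon$-class $X$ is $l$-strong and $\varepsilon\subseteq\mathcal{L}_X$. Moreover, $\varepsilon$ and $\mathcal{L}_X$ coincide on $G\setminus {}_XW$, i.e. $\varepsilon\cap\big((G\setminus {}_XW)\times(G\setminus {}_XW)\big)=\mathcal{L}_X\cap\big((G\setminus {}_XW)\times(G\setminus {}_XW)\big)$.
   Context: Let $n$ be a positive integer. A Menger algebra $(G,o)$ of rank $n$ is a nonempty set $G$ with an $(n+1)$-ary operation $o:(f,g_1,\ldots,g_n)\mapsto f[g_1\ldots g_n]$ satisfying the superassociative law $f[g_1\ldots g_n][h_1\ldots h_n]=f[g_1[h_1\ldots h_n]\ldots g_n[h_1\ldots h_n]]$ for all $f,g_i,h_i\in G$. Put $B=G^n\cup\{\overline{e}\}$, where $\overline{e}=(e_1,\ldots,e_n)$ is a tuple of pairwise different formal symbols not in $G$. For $g\in G$ and $\overline{x}=(x_1,\ldots,x_n)\in G^n$ write $g[\overline{x}]=g[x_1\ldots x_n]$, and put $g[\overline{e}]=g$. A relation $\rho\subseteq G\times G$ is $l$-regular if $(x,y)\in\rho$ implies $(x[z_1\ldots z_n],y[z_1\ldots z_n])\in\rho$ for all $x,y,z_1,\ldots,z_n\in G$; an $l$-congruence is an $l$-regular equivalence relation. The relation $\rho$ is $l$-cancellative if for all $x,y\in G$ and $(z_1,\ldots,z_n)\in G^n$, $(x[z_1\ldots z_n],y[z_1\ldots z_n])\in\rho$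 implies $(x,y)\in\rho$. An $\varepsilon$-class is an equivalence class of $\varepsilon$. For $X\subseteq G$ and $g\in G$ put $\eta_X\langle g\rangle=\{\overline{x}\in B\mid g[\overline{x}]\in X\}$, ${}_XW=\{g\in G\mid\eta_X\langle g\rangle=\varnothing\}$, and $\mathcal{L}_X=\{(g_1,g_2)\in G\times G\mid\eta_X\langle g_1\rangle=\eta_X\langle g_2\rangle\}$. The subset $X$ is $l$-strong if for all $a,b\in G$, $\eta_X\langle a\rangle\cap\eta_X\langle b\rangle\neq\varnothing$ implies $\eta_X\langle a\rangle=\eta_X\langle b\rangle$. *)

(* Defs.v *)
From mathcomp Require Import all_boot.
From mathcomp Require Import boolp classical_sets.
From Stdlib Require Import RelationClasses.

Set Implicit Arguments.
Unset Strict Implicit.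
Unset Printing Implicit Defensive.

Local Open Scope classical_set_scope.

Record mengerAlgebra (n : nat) := MengerAlgebra {
  mcarrier :> Type;
  mop : mcarrier -> n.-tuple mcarrier -> mcarrier;
  mcarrier_inhabited : inhabited mcarrier;
  superassociative : forall (f : mcarrier) (g h : n.-tuple mcarrier),
    mop (mop f g) h = mop f [tuple of map (fun gi => mop gi h) g]
}.

Section Definitions.
Variables (n : nat) (G : mengerAlgebra n).
Implicit Types (rho : set (G * G)) (X : set G) (g : G).

(* G^n with one extra point adjoined: [Some x] is the tuple [x], and [None] is
   the tuple (e_1, ..., e_n) of formal symbols. *)
Definition extTuple := option (n.-tuple G).

Definition mact g (x : extTuple) : G := if x is Some z then mop g z else g.

Definition l_regular rho :=
  forall (x y : G) (z : n.-tuple G), rho (x, y) -> rho (mop x z, mop y z).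

Definition l_congruence rho :=
  Equivalence (fun x y : G => rho (x, y)) /\ l_regular rho.

Definition l_cancellative rho :=
  forall (x y : G) (z : n.-tuple G), rho (mop x z, mop y z) -> rho (x, y).

Definition is_class rho X := exists a : G, X = [set x | rho (a, x)].

Definition eta X g : set extTuple := [set x | X (mact g x)].

Definition Wset X : set G := [set g | eta X g = set0].

Definition Lrel X : set (G * G) := [set p | eta X p.1 = eta X p.2].

Definition l_strong X :=
  forall a b : G, eta X a `&` eta X b <> set0 -> eta X a = eta X b.

End Definitions.

(* Main.v *)
Require Import Defs.
From mathcomp Require Import all_boot.
From mathcomp Require Import boolp classical_sets.

Local Open Scope classical_set_scope.

(** Acting by a fixed [t] in [extTuple] preserves [eps] by regularity and reflects it by
    cancellation. Preservation makes [eta X] constant on [eps]-classes. Reflection shows that two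
    elements whose [eta X] sets meet are [eps]-related, hence have equal [eta X] sets: this is
    strength, and it reverses the inclusion wherever [eta X] is nonempty. *)

Lemma l_congruence_sub_Lrel (n : nat) (G : mengerAlgebra n)
    (eps : set (G * G)) (X : set G) :
  l_congruence eps -> is_class eps X -> eps `<=` Lrel X.
Proof.
move=> [[_ sym_eps trans_eps] reg_eps] [a ->] [x y] /= exy.
have act_xy t : eps (mact x t, mact y t).
  by case: t => [z|] //=; exact: reg_eps.
apply/seteqP; split=> t /= eat; apply: trans_eps eat _ => //.
exact: sym_eps.
Qed.

(** A common [t] sends both elements into the single class [X], so their images are [eps]-related
    and [t] can be cancelled. *)
Lemma l_cancellative_common_eta (n : nat) (G : mengerAlgebra n)
    (eps : set (G * G)) (X : set G) (x y : G) :
  l_congruence eps -> l_cancellative eps -> is_class eps X ->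
  eta X x `&` eta X y !=set0 -> eps (x, y).
Proof.
move=> [[_ sym_eps trans_eps] _] canc_eps [a ->] [t [/= eax eay]].
have : eps (mact x t, mact y t) by apply: trans_eps eay; exact: sym_eps.
(* For the formal tuple [None] the action is the identity, so there is nothing to cancel. *)
by case: t {eax eay} => [z|] //=; exact: canc_eps.
Qed.

Theorem proposition3p10 (n : nat) (n_gt0 : 0 < n) (G : mengerAlgebra n)
    (eps : set (G * G)) (eps_cong : l_congruence eps)
    (eps_canc : l_cancellative eps) (X : set G) (X_class : is_class eps X) :
  [/\ l_strong X,
      eps `<=` Lrel X &
      eps `&` (~` Wset X `*` ~` Wset X) = Lrel X `&` (~` Wset X `*` ~` Wset X)].
Proof.
have eps_sub := @l_congruence_sub_Lrel _ _ _ _ eps_cong X_class.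
split=> //.
- move=> a b /eqP/set0P ab_meet; apply: (eps_sub (a, b)).
  exact: l_cancellative_common_eta ab_meet.
- apply/seteqP; split=> [p [/eps_sub]|[x y] [Lxy [/= xW yW]]]; first by [].
  split=> //; apply: l_cancellative_common_eta eps_cong eps_canc X_class _.
  (* Both sets equal [eta X y], which is nonempty as [y] lies outside [Wset X]. *)
  by rewrite [eta X x]Lxy setIid; apply/set0P/eqP.
Qed.
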